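(* Let $b$ be even and $a\ge b\ge 2$. If the spider $S(a,b,1)$ is $e$-positive, then: (1) if $b\equiv 2\pmod 3$, then either $a\equiv 0\pmod 3$ and $a\le 2b+2$, or $a\equiv1\pmod 3$ and $a\le 2b-3$ (in particular $a\not\equiv 2\pmod 3$); (2) if $b\not\equiv 2\pmod 3$, then $a\le b^2-1$ or $a=b^2+b$; (3) if $a$ is even, then $a>b+\frac{1+\sqrt{8b-3}}{2}$. *)

(* Defs.v *)
From HB Require Import structures.
From mathcomp Require Import all_boot all_order all_algebra.
From mathcomp Require Import mpoly.
From mathcomp.real_closed Require Import realalg.

Set Implicit Arguments. Unset Strict Implicit. Unset Printing Implicit Defensive.
Import Order.TTheory GRing.Theory Num.Theory.
Local Open Scope ring_scope.

(* Spider S(a,b,c): vertices 0..a+b+c (as 'I_(a+b+c+1)); 0 is the center,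
   legs are the paths 1-2-..-a, (a+1)-..-(a+b), (a+b+1)-..-(a+b+c),
   with 0 adjacent to the first vertex 1, a+1, a+b+1 of each leg. *)
Definition spider_edge (a b c : nat) (u v : nat) : bool :=
  ((u == 0%N) && [|| v == 1%N, v == (a + 1)%N | v == (a + b + 1)%N])
  || [&& (1 <= u)%N, v == u.+1, (v <= a + b + c)%N,
         v != (a + 1)%N & v != (a + b + 1)%N].

Definition spider_adj (a b c : nat) : rel 'I_(a + b + c + 1) :=
  fun u v => spider_edge a b c u v || spider_edge a b c v u.

Definition proper_col (n N : nat) (adj : rel 'I_n) (k : {ffun 'I_n -> 'I_N}) : bool :=
  [forall u, forall v, adj u v ==> (k u != k v)].

Definition chromsym (n N : nat) (adj : rel 'I_n) : {mpoly rat[N]} :=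
  \sum_(k : {ffun 'I_n -> 'I_N} | proper_col adj k) \prod_(v < n) 'X_(k v).

(* a partition of n encoded by multiplicities: m i = multiplicity of part i+1 *)
Definition is_partn (n : nat) (m : {ffun 'I_n -> 'I_n.+1}) : bool :=
  (\sum_(i < n) i.+1 * m i)%N == n.

Definition e_part (n N : nat) (m : {ffun 'I_n -> 'I_n.+1}) : {mpoly rat[N]} :=
  \prod_(i < n) (mesym N rat i.+1) ^+ (m i).

(* e-positivity of a graph on n vertices: X_G (taken in n variables, where the
   e_lambda, lambda |- n, are linearly independent) is a nonnegative
   combination of the e_lambda. *)
Definition e_positive (n : nat) (adj : rel 'I_n) : Prop :=
  exists c : {ffun 'I_n -> 'I_n.+1} -> rat,
    (forall m, 0 <= c m) /\
    chromsym n adj = \sum_(m | is_partn m) c m *: e_part n m.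

(* Main.v *)
(** Summing over the colour of the centre, the spider with legs a, b, 1 has
    X = X(P_n) + e_1 X(P_(n-1)) - X(P_(a+1)) X(P_(b+1)) with n = a + b + 2, and
    X(P_n) = e_n + sum_(k >= 2) (k - 1) e_k X(P_(n-k)).  Since the e_k are
    algebraically independent, e-positivity survives any substitution of
    polynomials with nonnegative coefficients for the e_k.  Each bound comes from
    the coefficient in X of a single e_lambda:
    - k^m with k dividing both a + 1 and b + 1 is always negative;
    - 3^m 4 and 3^m 2 when 3 divides b + 1 (part 1);
    - (b+1)^m r and (b+1)^m (b+2), where r = (a+1) mod (b+1) (part 2);
    - 2^m 3 3 when a and b are even (part 3). *)
Require Import Defs.
From HB Require Import structures.
From mathcomp Require Import all_boot all_order all_algebra.
From mathcomp Require Import mpoly.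
From mathcomp.real_closed Require Import realalg.
From mathcomp Require Import zify ring lra.
Import Order.TTheory GRing.Theory Num.Theory.

(** * Path weights and their recursion in the elementary symmetric functions *)

Section PathSums.
Set Implicit Arguments. Unset Strict Implicit.
Local Open Scope ring_scope.
Variables (R : comNzRingType) (N : nat) (x : 'I_N -> R).

(* The sum of the weights of the proper colourings of a path with n vertices, one
   end of which is attached to an extra vertex of colour i. *)
Fixpoint leg (n : nat) (i : 'I_N) : R :=
  if n is m.+1 then \sum_(j | j != i) x j * leg m j else 1.

Definition pathsum (n : nat) : R :=
  if n is m.+1 then \sum_i x i * leg m i else 1.

Lemma legS n i : leg n.+1 i = pathsum n.+1 - x i * leg n i.
Proof. by rewrite /= [in RHS](bigD1 i) //= addrAC subrr add0r. Qed.

Lemma sum_legS a b :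
  \sum_i x i * leg a.+1 i * leg b i =
  pathsum a.+1 * pathsum b.+1 - \sum_i x i ^+ 2 * leg a i * leg b i.
Proof.
rewrite {2}/pathsum mulr_sumr -sumrB; apply: eq_bigr => i _.
by rewrite legS; ring.
Qed.

(** By [sum_legS], the sums for legs (a+1, b) and (a, b+1) are the same expression, symmetric in a
    and b; so vertices can move from one leg to the other. *)
Lemma sum_leg2 a b : \sum_i x i * leg a i * leg b i = pathsum (a + b).+1.
Proof.
elim: a b => [|a IHa] b.
  by rewrite add0n; apply: eq_bigr => i _; rewrite mulr1.
rewrite addSnnS -IHa sum_legS; under [in RHS]eq_bigr => i _ do rewrite mulrAC.
by rewrite sum_legS mulrC; congr (_ - _); apply: eq_bigr => i _; ring.
Qed.

(** [legS] turns the one-vertex leg into [pathsum 1 - x i]; [sum_legS] and [sum_leg2] evaluate the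
    sum with [x i ^+ 2] that arises. *)
Lemma sum_leg3 a b :
  \sum_i x i * leg a i * leg b i * leg 1 i =
  pathsum (a + b).+2 + pathsum 1 * pathsum (a + b).+1
  - pathsum a.+1 * pathsum b.+1.
Proof.
rewrite -[(a + b).+2]/(a.+1 + b).+1 -!sum_leg2 sum_legS.
rewrite [RHS]addrAC [X in X + _]addrAC subrr add0r addrC mulr_sumr -sumrB.
by apply: eq_bigr => i _; rewrite (legS 0) [leg 0 i]/=; ring.
Qed.

(** The k-th elementary symmetric function, taken as a coefficient of its generating product so that
    a factor can be split off and the product differentiated. *)
Definition esum (k : nat) : R := (\prod_i (1 + x i *: 'X) : {poly R})`_k.

Let epoly' i : {poly R} := \prod_(j | j != i) (1 + x j *: 'X).

Lemma esumE i k :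
  esum k = (epoly' i)`_k + x i * (if k is j.+1 then (epoly' i)`_j else 0).
Proof.
rewrite /esum (bigD1 i) //= -/(epoly' i) mulrDl mul1r coefD -scalerAl coefZ coefXM.
by case: k.
Qed.

(** Compare the coefficients of degree k in the derivative of the generating product. *)
Lemma esum_deriv k : k.+1%:R * esum k.+1 = \sum_i x i * (epoly' i)`_k.
Proof.
have dprod (s : seq 'I_N) : uniq s ->
    (\prod_(i <- s) (1 + x i *: 'X) : {poly R})^`() =
    \sum_(i <- s) x i *: \prod_(j <- s | j != i) (1 + x j *: 'X).
  elim: s => [|i s IHs] /=; first by rewrite !big_nil derivC.
  case/andP=> i_s us; rewrite !big_cons eqxx /= derivM derivD derivZ derivX derivC add0r.
  rewrite IHs // -scalerAl mul1r.
  have -> : \prod_(j <- s | j != i) (1 + x j *: 'X) =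
      \prod_(j <- s) (1 + x j *: 'X) :> {poly R}.
    rewrite big_seq_cond [RHS]big_seq; apply: eq_bigl => j.
    by case: (boolP (j \in s)) => //= js; apply: contraNneq i_s => <-.
  congr (_ + _); rewrite mulr_sumr big_seq [RHS]big_seq; apply: eq_bigr => j js.
  rewrite big_cons ifT; first by rewrite -scalerAr.
  by apply: contraNneq i_s => ->.
have := congr1 (fun p : {poly R} => p`_k) (dprod (index_enum 'I_N) (index_enum_uniq _)).
rewrite /= coef_deriv coef_sum mulr_natl /esum => ->.
by apply: eq_bigr => i _; rewrite coefZ.
Qed.

Lemma esum0 : esum 0 = 1.
Proof.
rewrite /esum; elim/big_rec: _ => [|i p _ IHp]; first by rewrite coefC eqxx.
by rewrite mulrDl mul1r coefD IHp -scalerAl coefZ coefXM eqxx mulr0 addr0.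
Qed.

(* For each i the generating series of the legs at i is P(T) / (1 + x_i T),
   where P is that of [pathsum]; multiply by E(T) = prod_i (1 + x_i T). *)
Lemma leg_convolution i m :
  \sum_(k < m.+1) esum k * leg (m - k) i =
  \sum_(k < m.+1) (epoly' i)`_k * pathsum (m - k).
Proof.
under eq_bigr => k _ do rewrite (esumE i) mulrDl.
rewrite big_split /= [X in _ + X]big_ord_recl mulr0 mul0r add0r.
rewrite big_ord_recr /= [in RHS]big_ord_recr /= subnn /= -addrA addrC -addrA addrC.
congr (_ + _); rewrite addrC -big_split; apply: eq_bigr => k _ /=.
have -> : (m - k = (m - k.+1).+1)%N by have := ltn_ord k; lia.
rewrite legS; ring.
Qed.

(** Sum [x i] times [leg_convolution] over i and apply [esum_deriv]. Moving the terms k > 0 of the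
    left side across lowers each factor k+1 to k, except in the last term, which leaves the extra
    [esum n.+1]. *)
Lemma pathsum_rec n :
  pathsum n.+1 = esum n.+1 + \sum_(k < n.+1) k%:R * esum k.+1 * pathsum (n - k).
Proof.
have conv : \sum_(k < n.+1) esum k * pathsum (n - k).+1 =
            \sum_(k < n.+1) k.+1%:R * esum k.+1 * pathsum (n - k).
  transitivity (\sum_i x i * \sum_(k < n.+1) esum k * leg (n - k) i).
    under [RHS]eq_bigr => i _ do rewrite mulr_sumr.
    rewrite exchange_big; apply: eq_bigr => k _ /=; rewrite mulr_sumr.
    by apply: eq_bigr => i _; ring.
  under eq_bigr => i _ do rewrite leg_convolution mulr_sumr.
  rewrite exchange_big; apply: eq_bigr => k _ /=; rewrite esum_deriv mulr_suml.
  by apply: eq_bigr => i _; ring.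
rewrite big_ord_recl esum0 mul1r subn0 in conv.
have -> : pathsum n.+1 = \sum_(k < n.+1) k.+1%:R * esum k.+1 * pathsum (n - k) -
   \sum_(i < n) esum (bump 0 i) * pathsum (n - bump 0 i).+1 by rewrite -conv addrK.
have -> : \sum_(k < n.+1) k.+1%:R * esum k.+1 * pathsum (n - k) =
  \sum_(k < n.+1) k%:R * esum k.+1 * pathsum (n - k) +
  \sum_(k < n.+1) esum k.+1 * pathsum (n - k).
  by rewrite -big_split; apply: eq_bigr => k _ /=; rewrite -natr1; ring.
rewrite addrC [X in _ + X = _]addrC addrA; congr (_ + _).
rewrite big_ord_recr /= subnn mulr1 addrA [X in X + _]addrC.
have -> : \sum_(i < n) esum (bump 0 i) * pathsum (n - bump 0 i).+1 =
   \sum_(i < n) esum i.+1 * pathsum (n - i).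
  by apply: eq_bigr => i _; rewrite /bump leq0n add1n subnSK.
by rewrite subrr add0r.
Qed.

End PathSums.

(** * Leg weights as sums over colour words *)

Section SpiderColourings.
Set Implicit Arguments. Unset Strict Implicit.
Local Open Scope ring_scope.
Variables (R : comNzRingType) (N : nat) (x : 'I_N -> R).

Let ne : rel 'I_N := fun u v => v != u.

Lemma leg_tuple n i :
  leg x n i = \sum_(t : n.-tuple 'I_N | path ne i t) \prod_(j <- t) x j.
Proof.
elim: n i => [|n IHn] i.
  rewrite /= (big_pred1 [tuple]) ?big_nil // => t.
  by rewrite (tuple0 t) /= eqxx.
rewrite /=; under eq_bigr => j _ do rewrite IHn mulr_sumr.
rewrite pair_big_dep /=.
have bij : bijective (fun p : 'I_N * n.-tuple 'I_N => [tuple of p.1 :: p.2]).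
  exists (fun t : n.+1.-tuple 'I_N => (thead t, [tuple of behead t])).
    by case=> j t; congr pair; apply: val_inj.
  by move=> t; apply: val_inj => /=; rewrite [in RHS](tuple_eta t).
rewrite [RHS](reindex _ (onW_bij _ bij)) /=.
by apply: eq_bigr => -[j t] _; rewrite big_cons.
Qed.

End SpiderColourings.

(** * Proper colourings of the spider, leg by leg *)

Section SpiderChromsym.
Set Implicit Arguments. Unset Strict Implicit.
Local Open Scope ring_scope.
Variables (a b N : nat).

Let ne : rel 'I_N := fun u v => v != u.
(** The list follows the vertex numbering of [spider_edge]: the centre, then the three legs. No
    vertex reaches the default i. *)
Let colour (i : 'I_N) (s1 s2 s3 : seq 'I_N) (m : nat) : 'I_N :=
  nth i (i :: s1 ++ s2 ++ s3) m.

Lemma spider_proper (i : 'I_N) (s1 : a.-tuple 'I_N) (s2 : b.-tuple 'I_N)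
    (s3 : 1.-tuple 'I_N) :
  proper_col (@spider_adj a b 1) [ffun v : 'I_(a + b + 1 + 1) => colour i s1 s2 s3 v] =
  [&& path ne i s1, path ne i s2 & path ne i s3].
Proof.
set T := colour i s1 s2 s3.
have T0 : T 0 = i by [].
have T1 m : (m < a)%N -> nth i s1 m = T m.+1.
  by move=> ma; rewrite /T /colour /= nth_cat size_tuple ma.
have T2 m : (m < b)%N -> nth i s2 m = T (a + m).+1.
  move=> mb; rewrite /T /colour /= nth_cat size_tuple ifF; last lia.
  by rewrite nth_cat size_tuple addKn mb.
have T3 : nth i s3 0 = T (a + b).+1.
  rewrite /T /colour /= nth_cat size_tuple ifF; last lia.
  by rewrite addKn nth_cat size_tuple ltnn subnn.
have edgeT u v : (u < a + b + 1 + 1)%N -> (v < a + b + 1 + 1)%N ->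
    spider_edge a b 1 u v ->
    [&& path ne i s1, path ne i s2 & path ne i s3] -> T u != T v.
  move=> ltu ltv E /and3P [/(pathP i) P1 /(pathP i) P2 /(pathP i) P3].
  rewrite !size_tuple in P1 P2 P3; rewrite eq_sym.
  case/orP: E => [/andP [/eqP -> /or3P [] /eqP Ev]|
      /and5P [u1 /eqP Ev vn va vb]]; rewrite Ev.
  (* If a = 0, vertex 1 already starts the second leg, and if also b = 0, the third. *)
  - have [a0|a0] := ltnP 0 a; first by have := P1 0 a0; rewrite T1.
    have [b0|b0] := ltnP 0 b.
      by have := P2 0 b0; rewrite T2 // addn0 (_ : a = 0)%N; last lia.
    by have := P3 0 isT; rewrite T3 (_ : a + b = 0)%N; last lia.
  - have [b0|b0] := ltnP 0 b; first by have := P2 0 b0; rewrite T2 // addn0 addn1.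
    by have := P3 0 isT; rewrite T3 (_ : a + b = a)%N ?addn1; last lia.
  - by have := P3 0 isT; rewrite T3 addn1.
  (* An edge avoiding the centre lies in the first or second leg, as the third has one vertex. *)
  case: u => // u in ltu u1 Ev *.
  have [ua|ua] := ltnP u.+1 a.
    by have := P1 _ ua; rewrite /ne T1 //= T1 //; lia.
  have [w Ew] : exists w, (u = a + w)%N by exists (u - a)%N; lia.
  have wb : (w.+1 < b)%N by lia.
  by have := P2 _ wb; rewrite /ne T2 //= T2 ?addnS -?Ew //; lia.
apply/idP/idP => [/forallP K|H].
  have {}K u v : (u < a + b + 1 + 1)%N -> (v < a + b + 1 + 1)%N ->
      spider_edge a b 1 u v -> T v != T u.
    move=> ltu ltv E; have /forallP /(_ (Ordinal ltv)) := K (Ordinal ltu).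
    by rewrite /spider_adj /= E /= !ffunE /= eq_sym.
  apply/and3P; split; apply/(pathP i) => m; rewrite size_tuple => lm; rewrite /ne.
  - rewrite T1 //; case: m lm => [|m] lm /=; last rewrite T1; try by lia.
      by rewrite -[X in _ != X]T0; apply: K; rewrite /spider_edge; lia.
    by apply: K; rewrite /spider_edge; lia.
  - rewrite T2 //; case: m lm => [|m] lm /=; last rewrite T2; try by lia.
      by rewrite -[X in _ != X]T0; apply: K; rewrite /spider_edge; lia.
    by apply: K; rewrite /spider_edge; lia.
  - have -> : m = 0%N by lia.
    by rewrite T3 /= -[X in _ != X]T0; apply: K; rewrite /spider_edge; lia.
apply/forallP => u; apply/forallP => v; apply/implyP; rewrite !ffunE => /orP [] E.
  exact: edgeT.
by rewrite eq_sym; apply: edgeT.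
Qed.

Lemma chromsym_spider_legs :
  chromsym N (@spider_adj a b 1) =
  \sum_i 'X_i * leg (fun i => 'X_i : {mpoly rat[N]}) a i
    * leg (fun i => 'X_i : {mpoly rat[N]}) b i
    * leg (fun i => 'X_i : {mpoly rat[N]}) 1 i.
Proof.
pose D := (('I_N * a.-tuple 'I_N) * (b.-tuple 'I_N * 1.-tuple 'I_N))%type.
pose F (p : D) : {ffun 'I_(a + b + 1 + 1) -> 'I_N} :=
  [ffun v : 'I_(a + b + 1 + 1) => colour p.1.1 p.1.2 p.2.1 p.2.2 v].
have szF (p : D) : size (p.1.1 :: p.1.2 ++ p.2.1 ++ p.2.2) = (a + b + 1 + 1)%N.
  by rewrite /= !size_cat !size_tuple; lia.
have bijF : bijective F.
  (* Both sides have N^(a+b+2) elements, so injectivity suffices. *)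
  apply: inj_card_bij; last first.
    by rewrite card_ffun !card_prod !card_tuple !card_ord !expnD expn1; lia.
  move=> p q eqF.
  have : p.1.1 :: p.1.2 ++ p.2.1 ++ p.2.2 = q.1.1 :: q.1.2 ++ q.2.1 ++ q.2.2.
    apply: (@eq_from_nth _ p.1.1); first by rewrite !szF.
    move=> m; rewrite szF => lm.
    have := congr1 (fun f : {ffun _} => f (Ordinal lm)) eqF.
    rewrite !ffunE /colour /= => ->; apply: set_nth_default.
    by rewrite szF.
  case: p q {eqF} => [[i s1] [s2 s3]] [[i' s1'] [s2' s3']] /= [<-] /eqP.
  rewrite !eqseq_cat ?size_tuple // => /and3P [/eqP e1 /eqP e2 /eqP e3].
  by congr (_, _, (_, _)); apply: val_inj.
rewrite /chromsym (reindex F (onW_bij _ bijF)) big_mkcond [LHS]/=.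
(* Giving improper words weight 0 lets the sum run over a full product, where it factors. *)
pose W i (t : seq 'I_N) : {mpoly rat[N]} :=
  if path ne i t then \prod_(j <- t) 'X_j else 0.
have legW n i : leg (fun i => 'X_i : {mpoly rat[N]}) n i =
    \sum_(t : n.-tuple 'I_N) W i t.
  by rewrite leg_tuple big_mkcond.
under [RHS]eq_bigr => i _ do rewrite !legW.
transitivity (\sum_(p : D) 'X_p.1.1 * W p.1.1 p.1.2 * (W p.1.1 p.2.1 * W p.1.1 p.2.2)).
  apply: eq_bigr => p _; rewrite spider_proper /W.
  case: (path ne _ p.1.2); last by rewrite mulr0 mul0r.
  case: (path ne _ p.2.1); last by rewrite mul0r mulr0.
  case: (path ne _ p.2.2); last by rewrite !mulr0.
  rewrite /= -mulrA -!big_cat.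
  transitivity (\prod_(j <- p.1.1 :: p.1.2 ++ p.2.1 ++ p.2.2) 'X_j : {mpoly rat[N]}).
    rewrite (big_nth p.1.1) szF big_mkord.
    by apply: eq_bigr => v _; rewrite ffunE.
  by rewrite big_cons.
rewrite -(pair_bigA _ (fun (q : 'I_N * a.-tuple 'I_N)
    (r : b.-tuple 'I_N * 1.-tuple 'I_N) =>
  'X_q.1 * W q.1 q.2 * (W q.1 r.1 * W q.1 r.2))) /=.
rewrite -(pair_bigA _ (fun (i : 'I_N) (s1 : a.-tuple 'I_N) =>
  \sum_(r : b.-tuple 'I_N * 1.-tuple 'I_N) 'X_i * W i s1 * (W i r.1 * W i r.2))) /=.
apply: eq_bigr => i _; under eq_bigr => s1 _ do rewrite -mulr_sumr.
rewrite -mulr_suml -mulr_sumr -[RHS]mulrA; congr (_ * _).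
by rewrite -(pair_bigA _ (fun (s2 : b.-tuple 'I_N) (s3 : 1.-tuple 'I_N) =>
  W i s2 * W i s3)) /= big_distrlr.
Qed.

End SpiderChromsym.

(** * Substitution for the elementary symmetric functions *)

Section EExpansion.
Set Implicit Arguments. Unset Strict Implicit.
Local Open Scope ring_scope.

(* [epath y n] is X(P_n) as a polynomial in the e_k, with [y k] substituted for
   e_k; [epaths y n] lists its values at n, n - 1, ..., 0. *)
Fixpoint epaths (R : comNzRingType) (y : nat -> R) (n : nat) : seq R :=
  if n is m.+1 then
    y m.+1 + \sum_(k < m.+1) k%:R * y k.+1 * (epaths y m)`_k :: epaths y m
  else [:: 1].

Definition epath (R : comNzRingType) (y : nat -> R) (n : nat) : R := (epaths y n)`_0.

Lemma epath_rec (R : comNzRingType) (y : nat -> R) n :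
  epath y n.+1 = y n.+1 + \sum_(k < n.+1) k%:R * y k.+1 * epath y (n - k).
Proof.
rewrite {1}/epath /=; congr (_ + _); apply: eq_bigr => k _; congr (_ * _).
elim: n k => [|n IHn] [[|k] lk] //.
by rewrite subSS -(IHn (Ordinal (lk : (k < n.+1)%N))).
Qed.

Lemma rmorph_epath (R S : comNzRingType) (f : {rmorphism R -> S}) (y : nat -> R)
    (z : nat -> S) n :
  (forall k, (0 < k <= n)%N -> f (y k) = z k) -> f (epath y n) = epath z n.
Proof.
elim/ltn_ind: n => -[|n] IHn yz; first by rewrite [LHS]rmorph1.
rewrite !epath_rec rmorphD rmorph_sum yz ?ltnSn //; congr (_ + _).
apply: eq_bigr => k _; have lk := ltn_ord k.
rewrite !rmorphM rmorph_nat yz ?IHn //; try by lia.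
by move=> j lj; apply: yz; lia.
Qed.

Lemma pathsum_epath (R : comNzRingType) (N : nat) (x : 'I_N -> R) n :
  pathsum x n = epath (esum x) n.
Proof.
elim/ltn_ind: n => -[|n] IHn //; rewrite pathsum_rec epath_rec.
by congr (_ + _); apply: eq_bigr => k _; rewrite IHn //; have := ltn_ord k; lia.
Qed.

Lemma esum_mesym N k : esum (fun i => 'X_i : {mpoly rat[N]}) k = mesym N rat k.
Proof.
rewrite /esum; under eq_bigr => i _ do rewrite addrC.
rewrite bigA_distr /mesym coef_sum [RHS]big_mkcond /=; apply: eq_bigr => h _.
have -> : \prod_i (if i \in h then 'X_i *: 'X else 1) =
          (\prod_(i in h) 'X_i : {mpoly rat[N]}) *: 'X^#|h| :> {poly {mpoly rat[N]}}.
  rewrite -big_mkcond /= -prodr_const.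
  elim/big_rec3: _ => [|i p q s _ ->]; first by rewrite scale1r.
  by rewrite -scalerAl -scalerAr scalerA.
rewrite coefZ coefXn eq_sym; case: eqP => _; by rewrite ?mulr1 ?mulr0.
Qed.

Lemma coefM_ge0 (R : numDomainType) (p q : {poly R}) :
  (forall i, 0 <= p`_i) -> (forall i, 0 <= q`_i) -> forall i, 0 <= (p * q)`_i.
Proof.
by move=> p0 q0 i; rewrite coefM sumr_ge0 // => j _; apply: mulr_ge0.
Qed.

(** Both sides of the e-expansion are lifted to polynomials in formal variables standing for the
    e_k. Algebraic independence makes the lifts equal, and then [y] can be substituted. *)
Lemma e_positive_spider_coef a b (y : nat -> {poly rat}) i :
  (forall k j, 0 <= (y k)`_j) ->
  e_positive (@spider_adj a b 1) ->
  (epath y a.+1 * epath y b.+1)`_i <=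
  (epath y (a + b).+2 + y 1%N * epath y (a + b).+1)`_i.
Proof.
move=> y0 [c [c0]]; rewrite chromsym_spider_legs sum_leg3 !pathsum_epath.
set N := (a + b + 1 + 1)%N.
(* The variable of index k-1 stands for e_k; for k > N the value 0 matches e_k = 0 in N
   variables. *)
pose z k : {mpoly rat[N]} :=
  if k is j.+1 then (if insub j is Some i then 'X_i else 0) else 1.
pose S : N.-tuple {mpoly rat[N]} := [tuple mesym N rat i.+1 | i < N].
have zS k : (0 < k)%N -> z k \mPo S = esum (fun i => 'X_i : {mpoly rat[N]}) k.
  case: k => // k _; rewrite esum_mesym /z; case: insubP => [j _ <-|].
    by rewrite comp_mpolyXU -tnth_nth tnth_mktuple.
  by rewrite -leqNgt comp_mpoly0 => ?; rewrite mesym_geqnE.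
pose t := epath z (a + b).+2 + epath z 1 * epath z (a + b).+1
          - epath z a.+1 * epath z b.+1.
pose Z (m : {ffun 'I_N -> 'I_N.+1}) : {mpoly rat[N]} := \prod_i 'X_i ^+ m i.
have ep n : epath z n \mPo S = epath (esum (fun i => 'X_i : {mpoly rat[N]})) n.
  by apply: rmorph_epath => k /andP [k0 _]; apply: zS.
rewrite -!ep -!rmorphM -rmorphD -rmorphB /= -/t.
have -> : \sum_(m | is_partn m) c m *: e_part N m =
    (\sum_(m | is_partn m) c m *: Z m) \mPo S.
  rewrite rmorph_sum; apply: eq_bigr => m _ /=; rewrite comp_mpolyZ rmorph_prod.
  congr (_ *: _); apply: eq_bigr => j _.
  by rewrite rmorphXn /= comp_mpolyXU -tnth_nth tnth_mktuple.
move/msym_fundamental_un => tE.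
pose f : {rmorphism {mpoly rat[N]} -> {poly rat}} := mmap polyC (fun i : 'I_N => y i.+1).
have fz n : (n <= N)%N -> f (epath z n) = epath y n.
  move=> nN; apply: rmorph_epath => -[|k] //= kn.
  case: insubP => [j _ <-|]; last lia.
  by rewrite /f /= mmapX mmap1U.
have : forall i, 0 <= (f t)`_i.
  move=> {}i; rewrite tE rmorph_sum coef_sum; apply: sumr_ge0 => m _.
  rewrite [f _]mmapZ coefCM mulr_ge0 // (rmorph_prod f).
  move: i; apply: (big_ind (fun p : {poly rat} => forall i, 0 <= p`_i)).
  - by move=> i; rewrite coefC; case: eqP.
  - exact: coefM_ge0.
  move=> j _.
  rewrite rmorphXn [f _]mmapX mmap1U; elim: (m j : nat) => [|l IHl].
    by move=> i; rewrite expr0 coefC; case: eqP.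
  by rewrite exprS; apply: coefM_ge0.
rewrite /t rmorphB rmorphD !rmorphM !fz /N; try by lia.
move/(_ i); rewrite coefB subr_ge0.
by rewrite [epath y 1]epath_rec big_ord_recl big_ord0 !mul0r !addr0.
Qed.

End EExpansion.

(** * Path coefficients at partitions with two part sizes *)

Section TwoParts.
Set Implicit Arguments. Unset Strict Implicit.
Local Open Scope ring_scope.
Variables (R : comNzRingType) (h s : nat).

(* With this substitution for the e_k, the coefficient of 'X^c collects the
   e_lambda whose parts are c copies of s+1 and otherwise all h+1. *)
Definition two_parts (j : nat) : {poly R} :=
  (j == h.+1)%:R + 'X *+ (j == s.+1).

Lemma two_partsS k : two_parts k.+1 = (k == h)%:R + 'X *+ (k == s).
Proof. by []. Qed.

Lemma epath_two_parts n : h != s ->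
  epath two_parts n.+1 = two_parts n.+1
    + (if (h <= n)%N then epath two_parts (n - h) *+ h else 0)
    + (if (s <= n)%N then ('X * epath two_parts (n - s)) *+ s else 0).
Proof.
move=> hs; rewrite epath_rec -[RHS]addrA; congr (_ + _).
transitivity (
  \sum_(k < n.+1) (if k == h :> nat then epath two_parts (n - h) *+ h else 0) +
  \sum_(k < n.+1) (if k == s :> nat then ('X * epath two_parts (n - s)) *+ s else 0)).
  rewrite -big_split; apply: eq_bigr => k _ /=; rewrite two_partsS.
  case: eqP => [->|_]; case: eqP => [E|_]; rewrite !(mulr0n, mulr1n).
  - by rewrite E eqxx in hs.
  - by rewrite !addr0 mulr1 mulr_natl.
  - by rewrite E !add0r -mulrA mulr_natl.
  - by rewrite !addr0 mulr0 mul0r.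
have pick1 m p : \sum_(k < n.+1) (if k == m :> nat then p else 0) =
    (if (m <= n)%N then p else 0) :> {poly R}.
  rewrite -big_mkcond /=; have [mn|nm] := leqP m n.
    by rewrite (big_pred1 (Ordinal (mn : (m < n.+1)%N))).
  by rewrite big_pred0 // => k; have := ltn_ord k; lia.
by rewrite !pick1.
Qed.

Let u c n : R := (epath two_parts n)`_c.

Lemma two_parts_coef0 n : h != s ->
  u 0 n.+1 = (n == h)%:R + (if (h <= n)%N then h%:R * u 0 (n - h) else 0).
Proof.
move=> hs; rewrite /u epath_two_parts // two_partsS !coefD coefMn coefX mul0rn addr0.
rewrite -polyC_natr coefC eqxx -addrA; congr (_ + _); case: (h <= n)%N; case: (s <= n)%N;
  by rewrite ?coefMn ?coefXM ?coef0 ?mul0rn ?addr0 ?mulr_natl.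
Qed.

Lemma two_parts_coefS c n : h != s ->
  u c.+1 n.+1 = ((n == s) && (c == 0%N))%:R
   + (if (h <= n)%N then h%:R * u c.+1 (n - h) else 0)
   + (if (s <= n)%N then s%:R * u c (n - s) else 0).
Proof.
move=> hs; rewrite /u epath_two_parts // two_partsS !coefD coefMn coefX eqSS.
rewrite -polyC_natr coefC /= add0r -mulrnA mulnb andbC; congr (_ + _ + _).
  by case: (h <= n)%N; rewrite ?coefMn ?coef0 ?mulr_natl.
by case: (s <= n)%N; rewrite ?coefMn ?coef0 ?coefXM ?mulr_natl.
Qed.

(** Each factor ['X] uses up s+1 vertices. *)
Lemma two_parts_coef_small c n : h != s -> (n < c * s.+1)%N -> u c n = 0.
Proof.
move=> hs; elim/ltn_ind: n c => -[|n] IHn [|c] // ln; first by rewrite /u coefC.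
rewrite two_parts_coefS // andbC; case: eqP => [c0|_] /=.
  rewrite (_ : (n == s) = false) ?add0r; last lia.
  rewrite (_ : (s <= n)%N = false) ?addr0; last lia.
  by case: ifP => // hn; rewrite IHn ?mulr0 //; lia.
rewrite add0r; have [hn|_] := leqP h n; have [sn|_] := leqP s n;
  rewrite ?add0r ?addr0 // ?IHn ?mulr0 ?addr0 //; lia.
Qed.

Lemma two_parts_coef0_ndvd n : h != s -> ~~ (h.+1 %| n)%N -> u 0 n = 0.
Proof.
move=> hs; elim/ltn_ind: n => -[|n] IHn // dn; rewrite two_parts_coef0 //.
case: eqP dn => [->|_ dn]; first by rewrite dvdnn.
rewrite add0r; case: ifP => // hn; rewrite IHn ?mulr0 //; first lia.
by rewrite (_ : n.+1 = (n - h + h.+1)%N) ?dvdn_addl // in dn; lia.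
Qed.

(** Each recursion step contributes h; the path on h+1 vertices contributes h+1, from h times the
    empty path plus the free term. *)
Lemma two_parts_coef0_mul m : h != s -> u 0 (h.+1 * m.+1) = (h.+1 * h ^ m)%:R.
Proof.
move=> hs; elim: m => [|m IHm].
  rewrite muln1 two_parts_coef0 // eqxx leqnn subnn [u 0 0]coefC.
  by rewrite mulr1 addrC natr1.
have -> : (h.+1 * m.+2 = (h.+1 * m.+1 + h).+1)%N by lia.
rewrite two_parts_coef0 // ifT; last lia.
rewrite (_ : _ == h = false) ?add0r; last lia.
by rewrite addnK IHm -natrM expnS mulnCA.
Qed.

(** The factor h on the left avoids the exponent i-1, which would fail at i = 0. In the induction,
    the recursion splits off either a part h+1 or the single part s+1. *)
Lemma two_parts_coef1 i : h != s ->
  h%:R * u 1 (h.+1 * i + s.+1) = (h ^ i * (s * i * h.+1 + s.+1 * h))%:R.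
Proof.
move=> hs; elim: i => [|i IHi].
  rewrite muln0 add0n two_parts_coefS // eqxx leqnn subnn [u 0 0]coefC /=.
  have -> : (if (h <= s)%N then h%:R * u 1 (s - h) else 0) = 0.
    by case: ifP => // _; rewrite two_parts_coef_small ?mulr0 //; lia.
  by rewrite addr0 mulr1 addrC natr1 -natrM mul1n muln0 add0n mulnC.
rewrite addnS two_parts_coefS // addnK ifT; last lia.
rewrite ifT ?leq_addl // (_ : _ == s = false) ?add0r; last lia.
have -> : (h.+1 * i.+1 + s - h = h.+1 * i + s.+1)%N by lia.
rewrite IHi two_parts_coef0_mul // -natrM -natrD -natrM; congr (_%:R).
by rewrite expnS; ring.
Qed.

End TwoParts.

(** * Inequalities forced by single coefficients *)

Section NecessaryConditions.
Set Implicit Arguments. Unset Strict Implicit.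
Local Open Scope ring_scope.

Lemma two_parts_ge0 (R : numDomainType) h s k j : 0 <= (two_parts R h s k)`_j.
Proof.
rewrite coefD coefMn coefX -polyC_natr coefC addr_ge0 ?mulrn_wge0 ?ler0n //.
by case: ifP; rewrite ?ler0n.
Qed.

(** Splitting off a 2 has weight 1 and a 3 weight 2, so step i adds 2(4(i+1)+3), by
    [two_parts_coef1]. *)
Lemma two_parts_2_3_coef2 (R : comNzRingType) i :
  (epath (two_parts R 1 2) (2 * i + 6)%N)`_2 = ((i + 1) * (4 * i + 6))%N%:R.
Proof.
elim: i => [|i IHi]; last first.
  have -> : (2 * i.+1 + 6 = (2 * i + 7).+1)%N by lia.
  rewrite two_parts_coefS // andbF add0r !ifT; try lia.
  have -> : (2 * i + 7 - 1 = 2 * i + 6)%N by lia.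
  have -> : (2 * i + 7 - 2 = 2 * i.+1 + 3)%N by lia.
  have := two_parts_coef1 R i.+1 (isT : 1 != 2)%N; rewrite mul1r => ->.
  by rewrite IHi mul1r -natrM -natrD exp1n; congr (_%:R); ring.
rewrite two_parts_coefS //= (_ : (5 - 1 = 4)%N) // (_ : (5 - 2 = 3)%N) //.
rewrite two_parts_coef_small //.
have := two_parts_coef1 R 0 (isT : 1 != 2)%N; rewrite mul1r => ->.
by rewrite mulr0 !add0r -natrM.
Qed.

Variables a b : nat.
Hypothesis epos : e_positive (@spider_adj a b 1).

(** Positive h and s exclude the part 1, which kills the term e_1 X(P_(n-1)). *)
Lemma e_positive_two_parts h s i : (0 < h)%N -> (0 < s)%N ->
  (epath (two_parts rat h s) a.+1 * epath (two_parts rat h s) b.+1)`_i <=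
  (epath (two_parts rat h s) (a.+1 + b.+1))`_i.
Proof.
move=> h0 s0.
have := e_positive_spider_coef (y := two_parts rat h s) i (@two_parts_ge0 rat h s) epos.
rewrite two_partsS; case: h s h0 s0 => // h [|s] // _ _.
by rewrite !mulr0n addr0 mul0r addr0 addSn addnS.
Qed.

Lemma e_positive_coprime k : (1 < k)%N -> (k %| a.+1)%N -> (k %| b.+1)%N -> False.
Proof.
case: k => [|[|h]] // _ /dvdnP [[|m] Ea] // /dvdnP [[|l] Eb] //.
(* The second index only has to differ from the first: just the coefficient of degree 0 is read. It
   would require k^2 <= k(k-1). *)
have hs : h.+1 != h.+2 by lia.
have := e_positive_two_parts 0 (isT : 0 < h.+1)%N (isT : 0 < h.+2)%N.
rewrite coef0M Ea Eb.
have -> : (m.+1 * h.+2 + l.+1 * h.+2 = h.+2 * (m + l.+1).+1)%N by lia.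
rewrite ![(_ * h.+2)%N]mulnC.
rewrite !two_parts_coef0_mul // -natrM ler_nat addnS !expnS expnD.
have : (0 < h.+1 ^ m * h.+1 ^ l)%N by rewrite muln_gt0 !expn_gt0.
nia.
Qed.

Lemma e_positive_parts_k_r k r i j : (1 < k)%N -> (1 < r)%N -> ~~ (k %| r)%N ->
  a.+1 = (k * i + r)%N -> b.+1 = (k * j)%N ->
  (r * (k - 1) + (r - 1) * k * i <= (r - 1) * k * ((k - 1) * j))%N.
Proof.
case: k => [|h] //; case: r => [|s] //; rewrite !subn1 /= !ltnS => h0 s0 dv Ea.
case: j => [|j] Eb; first by rewrite muln0 in Eb.
have hs : h != s by apply: contraNneq dv => ->.
have := e_positive_two_parts 1 h0 s0.
rewrite coefM !big_ord_recl big_ord0 addr0 /= /bump /= subn0 subnn Ea Eb.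
(* Since k does not divide a+1, the part r can only come from the path on a+1 vertices. *)
rewrite [X in X * _ + _]two_parts_coef0_ndvd ?mul0r ?add0r //; last first.
  by rewrite dvdn_addr ?dvdn_mulr.
rewrite addn0 (_ : h.+1 * i + s.+1 + h.+1 * j.+1 = h.+1 * (i + j.+1) + s.+1)%N; last lia.
rewrite -(@ler_pM2l _ h%:R) ?ltr0n // mulrA !two_parts_coef1 // two_parts_coef0_mul //.
rewrite -natrM ler_nat addnS expnS expnD.
set X := (s * i * h.+1 + s.+1 * h)%N => le1.
have : (X * h.+1 <= h * (s * (i + j).+1 * h.+1 + s.+1 * h))%N.
  have p0 : (0 < h ^ i * h ^ j)%N by rewrite muln_gt0 !expn_gt0 h0.
  rewrite -(leq_pmul2l p0); apply: leq_trans (leq_trans le1 _); apply: eq_leq; ring.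
(* Writing k = h+1, the summand X * h on the left cancels against part of the right side. *)
by rewrite /X; nia.
Qed.

(** Both a+1 and b+1 are odd, so in the product each path supplies exactly one of the two parts
    3. *)
Lemma e_positive_2_3 i j : a.+1 = (2 * i + 3)%N -> b.+1 = (2 * j + 3)%N ->
  ((4 * i + 3) * (4 * j + 3) <= (i + j + 1) * (4 * (i + j) + 6))%N.
Proof.
move=> Ea Eb.
have := e_positive_two_parts 2 (isT : 0 < 1)%N (isT : 0 < 2)%N.
rewrite coefM !big_ord_recl big_ord0 addr0 /= /bump /= Ea Eb.
rewrite (_ : (2 - 0 = 2)%N) // (_ : (2 - (1 + 0) = 1)%N) // (_ : (2 - (1 + (1 + 0)) = 0)%N) //.
have odd0 l : (epath (two_parts rat 1 2) (2 * l + 3))`_0 = 0.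
  by rewrite two_parts_coef0_ndvd //; lia.
have coef1 l : (epath (two_parts rat 1 2) (2 * l + 3))`_1 = (4 * l + 3)%:R.
  have := two_parts_coef1 rat l (isT : 1 != 2)%N; rewrite mul1r => ->.
  by rewrite exp1n; congr (_%:R); ring.
rewrite !odd0 mul0r mulr0 add0r addr0 !coef1.
have -> : (2 * i + 3 + (2 * j + 3) = 2 * (i + j) + 6)%N by lia.
by rewrite two_parts_2_3_coef2 -natrM ler_nat.
Qed.

End NecessaryConditions.

(** * The three bounds from suitable parts *)

Theorem theorem3p3 (a b : nat) :
  ~~ odd b -> (2 <= b)%N -> (b <= a)%N ->
  e_positive (@spider_adj a b 1) ->
  [/\ (b %% 3 = 2)%N ->
        ((a %% 3 = 0)%N /\ (a <= 2 * b + 2)%N) \/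
        ((a %% 3 = 1)%N /\ (a <= 2 * b - 3)%N),
      (b %% 3 <> 2)%N -> (a <= b ^ 2 - 1)%N \/ a = (b ^ 2 + b)%N
    & ~~ odd a ->
        ((b%:R + (1 + Num.sqrt ((8 * b)%:R - 3)) / 2 : realalg) < a%:R)%R].
Proof.
move=> b_even b2 ba epos; split.
- move=> b3; have [j Ej] : exists j, b.+1 = (3 * j)%N by exists (b.+1 %/ 3)%N; lia.
  have a3 : (a %% 3 <> 2)%N.
    by move=> a3; apply: (e_positive_coprime epos (isT : 1 < 3)%N); lia.
  have [a0|a0] : (a %% 3 = 0 \/ a %% 3 = 1)%N by lia.
  + left; split=> //.
    (* The remainder 1 is traded for a part 4, since parts must exceed 1. *)
    have [i Ei] : exists i, a.+1 = (3 * i + 4)%N by exists ((a.+1 - 4) %/ 3)%N; lia.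
    by have := e_positive_parts_k_r epos (isT : 1 < 3)%N (isT : 1 < 4)%N isT Ei Ej; lia.
  + right; split=> //.
    have [i Ei] : exists i, a.+1 = (3 * i + 2)%N by exists ((a.+1 - 2) %/ 3)%N; lia.
    by have := e_positive_parts_k_r epos (isT : 1 < 3)%N (isT : 1 < 2)%N isT Ei Ej; lia.
- move=> _; have [|a_ge] := leqP a (b ^ 2 - 1); [by left|right].
  have b1 : (1 < b.+1)%N by lia.
  have Eb : b.+1 = (b.+1 * 1)%N by rewrite muln1.
  have Ea := divn_eq a.+1 b.+1; set q := (_ %/ _)%N in Ea; set r := (_ %% _)%N in Ea.
  have ltr : (r < b.+1)%N by rewrite ltn_mod.
  have [r1|r_gt1] := leqP r 1.
    case: (r) r1 Ea => [|[|//]] _ Ea.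
      case: (e_positive_coprime epos b1 _ (dvdnn _)).
      by rewrite Ea addn0 dvdn_mull.
    (* Remainder 1: one copy of b+1 is merged with it into a part b+2. The bounds b <= q <= b then
       give a = b(b+1). *)
    have qb : (b <= q)%N by nia.
    have dv : ~~ (b.+1 %| b.+2)%N by rewrite -[b.+2]addn1 dvdn_addr // dvdn1; lia.
    have Ea' : a.+1 = (b.+1 * (q - 1) + b.+2)%N by nia.
    have := e_positive_parts_k_r epos b1 (isT : 1 < b.+2)%N dv Ea' Eb.
    rewrite !subn1 /= => le1.
    have : (q <= b)%N by nia.
    by nia.
  have dv : ~~ (b.+1 %| r)%N by rewrite gtnNdvd //; lia.
  have Ea' : a.+1 = (b.+1 * q + r)%N by nia.
  have := e_positive_parts_k_r epos b1 r_gt1 dv Ea' Eb.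
  rewrite !subn1 /= muln1 => le1; exfalso.
  (* With q >= b-1, [le1] gives r b <= (r-1)(b+1), that is r >= b+1, against [ltr]. *)
  have bq : (b.-1 <= q)%N.
    rewrite leqNgt; apply/negP => ltq.
    have := leq_mul (leqnn b.+1) ltq; lia.
  have := leq_mul (leqnn (r.-1 * b.+1)) bq.
  clearbody q r; case: (r) r_gt1 ltr le1 => [|t] //.
  case: (b) b2 => [|c] //= *; lia.
move=> a_even.
have [i Ei] : exists i, a.+1 = (2 * i + 3)%N by exists ((a - 2) %/ 2)%N; lia.
have [j Ej] : exists j, b.+1 = (2 * j + 3)%N by exists ((b - 2) %/ 2)%N; lia.
have le := e_positive_2_3 epos Ei Ej.
have [d Ed] : exists d, i = (j + d)%N by exists (i - j)%N; lia.
have Ea : a = (b + 2 * d)%N by lia.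
have d0 : (0 < d)%N by nia.
(* [le] amounts to 4d^2 - 2d >= 2b - 1; the left side is even, so it is at least 2b, which makes the
   bound strict. *)
have lt : (8 * b < (4 * d - 1) ^ 2 + 3)%N by nia.
rewrite Ea natrD.
have : (Num.sqrt ((8 * b)%:R - 3) < (4 * d - 1)%:R :> realalg)%R.
  rewrite -[ltRHS]ger0_norm ?ler0n // -sqrtr_sqr ltr_sqrt.
    by rewrite ltrBlDr -natrX -natrD ltr_nat.
  by rewrite exprn_gt0 // ltr0n; lia.
rewrite natrB; last lia.
rewrite !natrM; lra.
Qed.
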